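(* Let $d\ge 1$, let $c\in(0,1)$, and let $F\in\mathcal{F}$ be a distribution function that is twice differentiable on $\mathbb{R}^d_+\setminus\{0\}$. Assume that there exist $r>0$, $\zeta>0$ such that $m^{\triangledown}>0$ and $M_H<\infty$. For each $n\in\mathbb{N}^*$ let $F_n$ be an estimator of $F$ based on $n$ i.i.d. observations with distribution function $F$, and assume that for each $n$, with probability one, $F_n$ is a measurable function on $\mathbb{R}^d_+$. Let $1\le p<\infty$ and let $(v_n)_{n\in\mathbb{N}^*}$ and $(T_n)_{n\in\mathbb{N}^*}$ be positive increasing sequences such that $$v_n\int_{[0,T_n]^d}|F-F_n|^p\,\lambda(\mathrm{d}x)\longrightarrow 0\quad\text{in probability as } n\to\infty,$$ and such that for all $t$ with $|t-c|\le r$ one has $\partial L(t)^{T_1}\neq\emptyset$. Then $$p_n\, d_\lambda\big(L(c)^{T_n},L_n(c)^{T_n}\big)\longrightarrow 0\quad\text{in probability as } n\to\infty$$ for every increasing positive sequence $(p_n)_{n\in\mathbb{N}^*}$ such that $p_n=o\left(v_n^{\frac{1}{p+1}}\big/T_n^{\frac{(d-1)p}{p+1}}\right)$.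
   Context: $\mathbb{N}^*=\mathbb{N}\setminus\{0\}$. $\mathcal{F}$ is the set of continuous distribution functions $\mathbb{R}^d_+\to[0,1]$ (distribution functions of random vectors $\mathbf{X}=(X_1,\dots,X_d)$ with values in $\mathbb{R}^d_+$). Given an i.i.d. sample $\mathbf{X}_1,\dots,\mathbf{X}_n$ in $\mathbb{R}^d_+$ with distribution function $F\in\mathcal{F}$, $F_n$ denotes an estimator of $F$ based on this sample (a random real-valued function on $\mathbb{R}^d_+$). For $t\in(0,1)$ and $T>0$: $L(t)^T=\{x\in[0,T]^d: F(x)\ge t\}$ and $L_n(t)^T=\{x\in[0,T]^d: F_n(x)\ge t\}$. The symbol $\partial$ denotes the boundary; for $L(t)^T$ it is taken relative to $[0,T]^d$, so that artificial faces of the cube are not counted. For $r>0$, $\zeta>0$, let $E=B(\{x\in\mathbb{R}^d_+: |F(x)-c|\le r\},\zeta)$, where $B(S,\rho)=\bigcup_{x\in S}B(x,\rho)$ and $B(x,\rho)$ is the closed ball of $\mathbb{R}^d_+$ with centre $x$ and radius $\rho$. Set $$m^{\triangledown}=\inf_{x\in E}\|(\nabla F)_x\|,\qquad M_H=\sup_{x\in E}\|(HF)_x\|,$$ where $(\nabla F)_x$ is the gradient of $F$ at $x$ with Euclidean norm, and $(HF)_x$ is the Hessian matrix of $F$ at $x$ with the matrix norm induced by the Euclidean norm. $\lambda$ is Lebesgue measure on $\mathbb{R}^d$ and $d_\lambda(A_1,A_2)=\lambda(A_1\bigtriangleup A_2)$, where $\bigtriangleup$ is the symmetric difference. *)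

(* Defs.v *)
From HB Require Import structures.
From mathcomp Require Import all_boot all_order all_algebra.
From mathcomp Require Import all_classical all_reals all_analysis.

Set Implicit Arguments.
Unset Strict Implicit.
Unset Printing Implicit Defensive.

Import Order.TTheory GRing.Theory Num.Theory.
Import numFieldNormedType.Exports.

Local Open Scope classical_set_scope.
Local Open Scope ring_scope.

(* R^n is 'rV[R]_n, with the sigma-algebra generated by the coordinates
   (the Borel one), as the library does for n.-tuple T. *)
Definition rV_measurable (R : realType) (n : nat) : set (set 'rV[R]_n) :=
  g_sigma_preimage (fun (i : 'I_n) (x : 'rV[R]_n) => x 0 i).

Lemma rV_measurable0 (R : realType) (n : nat) : @rV_measurable R n set0.
Proof. exact: sigma_algebra0. Qed.

Lemma rV_measurableC (R : realType) (n : nat) (A : set 'rV[R]_n) :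
  rV_measurable A -> rV_measurable (~` A).
Proof. exact: sigma_algebraC. Qed.

Lemma rV_measurable_bigcup (R : realType) (n : nat) (A : (set 'rV[R]_n)^nat) :
  (forall i, rV_measurable (A i)) -> rV_measurable (\bigcup_i A i).
Proof. exact: sigma_algebra_bigcup. Qed.

Definition rV_display : measure_display. Proof. exact. Qed.

HB.instance Definition _ (R : realType) (n : nat) :=
  @isMeasurable.Build rV_display 'rV[R]_n (@rV_measurable R n)
    (@rV_measurable0 R n) (@rV_measurableC R n) (@rV_measurable_bigcup R n).


Lemma measurable_rV_coord (R : realType) (n : nat) (i : 'I_n) :
  measurable_fun [set: 'rV[R]_n] (fun x : 'rV[R]_n => x 0 i).
Proof.
move=> _ Y mY; rewrite setTI; apply: sub_sigma_algebra => /=.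
rewrite -bigcup_seq/=; exists i => /=; first by rewrite mem_index_enum.
by exists Y => //; rewrite setTI.
Qed.

Lemma measurable_fun_rVP (R : realType) (n : nat) (d : measure_display)
    (T : measurableType d) (f : T -> 'rV[R]_n) :
  (forall i, measurable_fun setT (fun t => f t 0 i)) -> measurable_fun setT f.
Proof.
move=> mf _ A mA; rewrite setTI; move: A mA.
apply: (@smallest_sub _ _ _ (fun A => measurable (f @^-1` A))).
  split => //=; first by rewrite preimage_set0.
  - by move=> A mA; rewrite setTD preimage_setC; exact: measurableC.
  - by move=> A mA; rewrite preimage_bigcup; exact: bigcup_measurable.
move=> A; rewrite -bigcup_seq/= => -[i _ [B mB <-]].
by rewrite setTI; rewrite -[X in measurable X]setTI; exact: mf.
Qed.

Definition rV_cons (R : realType) (n : nat) (x : R * 'rV[R]_n) : 'rV[R]_n.+1 :=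
  \row_i (if unlift ord0 i is Some j then x.2 0 j else x.1).

Lemma measurable_rV_cons (R : realType) (n : nat) :
  measurable_fun setT (@rV_cons R n).
Proof.
apply: measurable_fun_rVP => i.
case: (unliftP ord0 i) => [j ->|->].
  rewrite (_ : (fun _ => _) = (fun x : 'rV[R]_n => x 0 j) \o snd).
    by apply: measurableT_comp; [exact: measurable_rV_coord|exact: measurable_snd].
  by apply/funext => x; rewrite /rV_cons mxE liftK.
rewrite (_ : (fun _ => _) = fst); first exact: measurable_fst.
by apply/funext => x; rewrite /rV_cons mxE unlift_none.
Qed.

Definition rV_uncons (R : realType) (n : nat) (x : 'rV[R]_n.+1) : R * 'rV[R]_n :=
  (x 0 ord0, \row_j x 0 (lift ord0 j)).

Lemma rV_consK (R : realType) (n : nat) : cancel (@rV_cons R n) (@rV_uncons R n).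
Proof.
move=> [a y]; congr pair; first by rewrite mxE unlift_none.
by apply/rowP => j; rewrite !mxE liftK.
Qed.

Lemma measurable_rV_uncons (R : realType) (n : nat) :
  measurable_fun setT (@rV_uncons R n).
Proof.
apply: measurable_fun_pair; first exact: measurable_rV_coord.
apply: measurable_fun_rVP => j.
rewrite (_ : (fun _ => _) = (fun x : 'rV[R]_n.+1 => x 0 (lift ord0 j))).
  exact: measurable_rV_coord.
by apply/funext => x; rewrite mxE.
Qed.

Section lebesgue_rV_step.
Local Open Scope ereal_scope.
Context (R : realType) (n : nat).
Context (m : {sigma_finite_measure set 'rV[R]_n -> \bar R}).

Let mu : {measure set (measurableTypeR R * 'rV[R]_n)%type -> \bar R} :=
  @lebesgue_measure R \x m.

Definition lebesgue_rV_step : set 'rV[R]_n.+1 -> \bar R :=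
  pushforward (@lebesgue_measure R \x m) (@rV_cons R n).

Let step_measure : {measure set 'rV[R]_n.+1 -> \bar R} :=
  measure_function_pushforward__canonical__measure_function_Measure
    mu (@measurable_rV_cons R n).

Let step0 : lebesgue_rV_step set0 = 0.
Proof. exact: (measure0 step_measure). Qed.

Let step_ge0 A : 0 <= lebesgue_rV_step A.
Proof. exact: (measure_ge0 step_measure). Qed.

Let step_sigma_additive : semi_sigma_additive lebesgue_rV_step.
Proof. exact: (@measure_semi_sigma_additive _ _ _ step_measure). Qed.

HB.instance Definition _ := isMeasure.Build _ _ _ lebesgue_rV_step
  step0 step_ge0 step_sigma_additive.

Let step_sigma_finite : sigma_finite setT lebesgue_rV_step.
Proof.
have /sigma_finiteP[A [AT ndA Aoo]] := sigma_finiteT (@lebesgue_measure R).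
have /sigma_finiteP[B [BT ndB Boo]] := sigma_finiteT m.
exists (fun k => @rV_uncons R n @^-1` (A k `*` B k)) => [|k].
  rewrite -preimage_bigcup (_ : \bigcup_k _ = setT) ?preimage_setT//.
  rewrite -setXTT AT BT predeqE => -[x y]; split=> [[k _ [/= ? ?]]|].
    by split; exists k.
  move=> [/= [j _ Ajx] [k _ Bky]]; exists (maxn j k) => //; split.
  - by move: x Ajx; exact/subsetPset/ndA/leq_maxl.
  - by move: y Bky; exact/subsetPset/ndB/leq_maxr.
have [mA Aoo'] := Aoo k; have [mB Boo'] := Boo k.
split.
  rewrite -[X in measurable X]setTI; apply: measurable_rV_uncons => //.
  exact: measurableX.
rewrite /lebesgue_rV_step /pushforward -comp_preimage.
rewrite (_ : _ \o _ = id); last by apply/funext => x; exact: rV_consK.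
by rewrite preimage_id product_measure1E// lte_mul_pinfty// ge0_fin_numE.
Qed.

HB.instance Definition _ := Measure_isSigmaFinite.Build _ _ _ lebesgue_rV_step
  step_sigma_finite.

End lebesgue_rV_step.

(* Lebesgue measure on R^n: Dirac mass at the point of R^0, then the n-fold
   product of the one-dimensional Lebesgue measure. *)
Fixpoint lebesgue_rV (R : realType) (n : nat) :
    {sigma_finite_measure set 'rV[R]_n -> \bar R} :=
  if n is n'.+1 then lebesgue_rV_step (lebesgue_rV R n') else \d_(0 : 'rV[R]_0).

Lemma lebesgue_rV_box (R : realType) (n : nat)
    (A : 'I_n -> set (measurableTypeR R)) :
  (forall i, measurable (A i)) ->
  lebesgue_rV R n [set x : 'rV[R]_n | forall i, A i (x 0 i)] =
  (\prod_(i < n) lebesgue_measure (A i))%E.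
Proof.
elim: n A => [|n IHn] A mA.
  rewrite big_ord0 /= diracE mem_set//.
  by case.
have mbox : measurable [set x : 'rV[R]_n | forall i, A (lift ord0 i) (x 0 i)].
  have -> : [set x : 'rV[R]_n | forall i, A (lift ord0 i) (x 0 i)] =
      \bigcap_(i in [set: 'I_n]) [set x : 'rV[R]_n | A (lift ord0 i) (x 0 i)].
    by apply/seteqP; split=> x Ax i; [move=> _; exact: Ax|exact: (Ax i)].
  apply: fin_bigcap_measurable => // i _; rewrite -[X in measurable X]setTI.
  exact: (@measurable_rV_coord R n i measurableT _ (mA _)).
rewrite big_ord_recl -IHn// -product_measure1E//.
rewrite /= /lebesgue_rV_step /pushforward; congr (product_measure1 _ _ _).
rewrite predeqE => -[a y]; split=> /= [Ax|[Aa Ay] i].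
  split=> [|i]; first by have := Ax ord0; rewrite mxE unlift_none.
  by have := Ax (lift ord0 i); rewrite mxE liftK.
by case: (unliftP ord0 i) => [j ->|->]; rewrite mxE ?liftK ?unlift_none.
Qed.

Definition enorm (R : realType) (d : nat) (x : 'rV[R]_d) : R :=
  Num.sqrt (\sum_i x 0 i ^+ 2).

Definition opnorm (R : realType) (d : nat) (A : 'M[R]_d) : R :=
  sup [set enorm (v *m A) | v in [set v | enorm v <= 1]].

Definition orthant (R : realType) (d : nat) : set 'rV[R]_d :=
  [set x | forall i, 0 <= x 0 i].

Definition cube (R : realType) (d : nat) (T : R) : set 'rV[R]_d :=
  [set x | forall i, 0 <= x 0 i <= T].

Arguments orthant : clear implicits.
Arguments cube {R} d T.

(* A function on R^d_+ is a total function on 'rV[R]_d whose values outside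
   orthant R d never matter.  Accordingly, differentiability at x is Frechet
   differentiability relative to R^d_+ : increments y - x stay in R^d_+.  The
   gradient and the Hessian are still unique, also on the faces. *)
Definition is_gradient (R : realType) (d : nat) (F : 'rV[R]_d -> R)
    (x g : 'rV[R]_d) : Prop :=
  forall e : R, 0 < e -> \forall y \near within (orthant R d) (nbhs x),
    `|F y - F x - \sum_i g 0 i * (y - x) 0 i| <= e * enorm (y - x).

(* 0 where F is not differentiable *)
Definition gradient (R : realType) (d : nat) (F : 'rV[R]_d -> R)
    (x : 'rV[R]_d) : 'rV[R]_d :=
  xget 0 [set g | is_gradient F x g].

(* row-vector convention, as in the library's jacobian: H i j is the derivative
   in direction i of the j-th coordinate of the gradient *)
Definition is_hessian (R : realType) (d : nat) (F : 'rV[R]_d -> R)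
    (x : 'rV[R]_d) (H : 'M[R]_d) : Prop :=
  forall e : R, 0 < e -> \forall y \near within (orthant R d) (nbhs x),
    enorm (gradient F y - gradient F x - (y - x) *m H) <= e * enorm (y - x).

Definition hessian (R : realType) (d : nat) (F : 'rV[R]_d -> R)
    (x : 'rV[R]_d) : 'M[R]_d :=
  xget 0 [set H | is_hessian F x H].

Definition twice_differentiable_on (R : realType) (d : nat) (D : set 'rV[R]_d)
    (F : 'rV[R]_d -> R) : Prop :=
  forall x, D x ->
    (exists g, is_gradient F x g) /\ (exists H, is_hessian F x H).

Definition has_cdf (R : realType) (d : nat) (mu : set 'rV[R]_d -> \bar R)
    (F : 'rV[R]_d -> R) : Prop :=
  forall x, orthant R d x ->
    mu [set y | forall i, y 0 i <= x 0 i] = (F x)%:E.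

Definition continuous_cdf (R : realType) (d : nat) (F : 'rV[R]_d -> R) : Prop :=
  {within orthant R d, continuous F} /\
  exists mu : probability 'rV[R]_d R,
    mu (orthant R d) = 1%E /\ has_cdf mu F.

Definition upper_level (R : realType) (d : nat) (G : 'rV[R]_d -> R) (t T : R) :
    set 'rV[R]_d :=
  [set x | cube d T x /\ t <= G x].

(* topological boundary of A in the subspace topology of K, for A `<=` K *)
Definition relative_boundary (X : topologicalType) (K A : set X) : set X :=
  closure (A : set (subspace K)) `\` interior (A : set (subspace K)).

(* B({x in R^d_+ : |F(x) - c| <= r}, zeta), with closed Euclidean balls of R^d_+ *)
Definition level_band_nbhd (R : realType) (d : nat) (F : 'rV[R]_d -> R)
    (c r zeta : R) : set 'rV[R]_d :=
  [set y | orthant R d y /\ exists x,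
     [/\ orthant R d x, `|F x - c| <= r & enorm (y - x) <= zeta]].

(* The infimum and the supremum run over all of B({|F - c| <= r}, zeta), the
   origin included when it belongs to that set: there the value 0 of gradient
   makes the infimum 0 if F is not differentiable at 0, and the value 0 of hessian
   leaves the supremum unaffected if F is not twice differentiable at 0. *)
Definition inf_gradient (R : realType) (d : nat) (F : 'rV[R]_d -> R)
    (c r zeta : R) : \bar R :=
  ereal_inf [set (enorm (gradient F x))%:E | x in level_band_nbhd F c r zeta].

Definition sup_hessian (R : realType) (d : nat) (F : 'rV[R]_d -> R)
    (c r zeta : R) : \bar R :=
  ereal_sup [set (opnorm (hessian F x))%:E | x in level_band_nbhd F c r zeta].

Definition sym_diff_measure (R : realType) (d : nat) (A B : set 'rV[R]_d) :
    \bar R :=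
  lebesgue_rV R d (A `+` B).

Definition independent_RVs (R : realType) (dO dT : measure_display)
    (Omega : measurableType dO) (T : measurableType dT)
    (P : probability Omega R) (n : nat) (X : 'I_n -> {RV P >-> T}) : Prop :=
  forall A : 'I_n -> set T, (forall i, measurable (A i)) ->
    P (\bigcap_(i in [set: 'I_n]) (X i @^-1` A i)) =
    (\prod_(i < n) P (X i @^-1` A i))%E.

Definition iid_sample (R : realType) (d : nat) (dO : measure_display)
    (Omega : measurableType dO) (P : probability Omega R)
    (F : 'rV[R]_d -> R) (n : nat) (X : 'I_n -> {RV P >-> 'rV[R]_d}) : Prop :=
  [/\ independent_RVs X,
      forall i w, orthant R d (X i w)
    & forall i, has_cdf (distribution P (X i)) F].

(* a function of the data whose value at each point is a random variable *)
Definition estimator_from (R : realType) (d : nat) (dO : measure_display)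
    (Omega : measurableType dO) (P : probability Omega R) (n : nat)
    (X : 'I_n -> {RV P >-> 'rV[R]_d}) (Fn : Omega -> 'rV[R]_d -> R) : Prop :=
  exists phi : n.-tuple 'rV[R]_d -> 'rV[R]_d -> R,
    (forall x, orthant R d x ->
       measurable_fun [set: n.-tuple 'rV[R]_d] (fun s => phi s x)) /\
    (forall w x, orthant R d x -> Fn w x = phi [tuple X i w | i < n] x).

(* Convergence to 0 in probability.  The outer measure P^* makes sense of it for
   Z n not known to be measurable; it agrees with P on measurable events. *)
Definition cvg_probability0 (R : realType) (dO : measure_display)
    (Omega : measurableType dO) (P : probability Omega R)
    (Z : nat -> Omega -> \bar R) : Prop :=
  forall e : R, 0 < e ->
    mu_ext P [set w | (e%:E <= `|Z n w|)%E] @[n --> \oo] --> 0%E.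

(* sequences indexed by the positive integers: the term of index 0 is ignored *)
Definition positive_increasing (R : realType) (u : nat -> R) : Prop :=
  (forall n, (0 < n)%N -> 0 < u n) /\
  (forall m n, (0 < m)%N -> (m <= n)%N -> u m <= u n).

(* Main.v *)
Require Import Defs.
From HB Require Import structures.
From mathcomp Require Import all_boot all_order all_algebra.
From mathcomp Require Import all_classical all_reals all_analysis.
From mathcomp Require Import measurable_realfun ring lra.

Set Implicit Arguments.
Unset Strict Implicit.
Unset Printing Implicit Defensive.

Import Order.TTheory GRing.Theory Num.Theory.
Import numFieldNormedType.Exports.

Local Open Scope classical_set_scope.
Local Open Scope ring_scope.

(** Write [1] for the vector with all coordinates equal to 1 and [|.|] for the
    Euclidean norm.  Everything rests on the fact that a thin band
    [{x in [0,T]^d : |F x - c| <= eps}] has volume at most a constant times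
    [eps * T^(d-1)].

    Being a distribution function, [F] is nondecreasing in each coordinate, so
    the coordinates of its gradient are nonnegative and their sum, which is the
    derivative of [F] in the direction [1], is at least the norm of the gradient.
    Hence, as long as the values of [F] stay within [r] of [c], [F] grows along
    every diagonal at rate at least [m], a positive lower bound of the norm of
    the gradient near the level [c] ([diag_growth]).  In particular two points of
    the band that differ by [s *: 1] satisfy [s <= 2 * eps / m], so the translates
    of the band by the multiples of [(3 * eps / m) *: 1] are pairwise disjoint.
    About [T * m / (3 * eps)] of them fit in the cube [[0,2T]^d]; comparing
    volumes gives the bound ([packing_bound], [level_band_volume]).  It uses that
    Lebesgue measure is invariant under translation ([lebesgue_rV_shift]).

    A point of the symmetric difference of the upper level sets of [F] and [F_n]
    either lies in the band or satisfies [|F - F_n| >= eps].  By Markov's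
    inequality the measure of the symmetric difference is at most
    [K * eps * T^(d-1) + eps^(-p) * \int |F - F_n|^p] ([level_set_distance]).  For
    a small [eta], take [eps] so that [q_n * K * eps * T_n^(d-1) = eta]; as [q_n]
    and [T_n] are nondecreasing, this [eps] is small uniformly in [n].  On the
    event where [v_n * \int |F - F_n|^p < 1], the other term, multiplied by [q_n],
    is at most a constant times
    [(q_n * T_n^((d-1)p/(p+1)) / v_n^(1/(p+1)))^(p+1)], which tends to 0
    ([rate_bound]).  The probability of the complementary event tends to 0. *)

(** * Translation invariance of Lebesgue measure *)

Lemma measurable_rV_box (R : realType) (n : nat) (A : 'I_n -> set (measurableTypeR R)) :
  (forall i, measurable (A i)) ->
  measurable [set x : 'rV[R]_n | forall i, A i (x 0 i)].
Proof.
move=> mA; rewrite (_ : [set _ | _] =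
    \bigcap_(i in [set: 'I_n]) [set x : 'rV[R]_n | A i (x 0 i)]).
  apply: fin_bigcap_measurable => // i _; rewrite -[X in measurable X]setTI.
  exact: (@measurable_rV_coord R n i measurableT _ (mA i)).
by apply/seteqP; split=> x Ax i; [move=> _; exact: Ax|exact: (Ax i)].
Qed.

Lemma measurable_orthant (R : realType) (d : nat) : measurable (orthant R d).
Proof.
rewrite (_ : orthant R d = [set x | forall i, `[0, +oo[%classic (x 0 i)]).
  apply: (@measurable_rV_box R d (fun=> `[0, +oo[%classic)) => i.
  exact: measurable_itv.
by apply/seteqP; split=> x xP i; have := xP i; rewrite /= in_itv/= andbT.
Qed.

Lemma cube_box (R : realType) (d : nat) (T : R) :
  cube d T = [set x | forall i, `[0, T]%classic (x 0 i)].
Proof. by apply/seteqP; split=> x xP i; have := xP i; rewrite /= in_itv. Qed.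

Lemma measurable_cube (R : realType) (d : nat) (T : R) : measurable (cube d T).
Proof.
rewrite cube_box.
apply: (@measurable_rV_box R d (fun=> `[0, T]%classic)) => i.
exact: measurable_itv.
Qed.

Lemma lebesgue_rV_cube (R : realType) (d : nat) (T : R) : 0 <= T ->
  lebesgue_rV R d (cube d T) = (T ^+ d)%:E.
Proof.
move=> T0; rewrite cube_box.
rewrite (@lebesgue_rV_box R d (fun=> `[0, T]%classic)); last first.
  by move=> i; exact: measurable_itv.
rewrite (eq_bigr (fun=> T%:E)); last first.
  by move=> i _; rewrite lebesgue_measure_itv/= lte_fin -EFinB subr0;
    case: ltgtP T0 => // <-.
by rewrite prodEFin prodr_const card_ord.
Qed.

Lemma lebesgue_measure_shift (R : realType) (s : R) (A : set (measurableTypeR R)) :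
  measurable A ->
  lebesgue_measure ((fun x : R => x + s) @^-1` A) = lebesgue_measure A.
Proof.
pose shift_s : measurableTypeR R -> measurableTypeR R := fun x => x + s.
have ms : measurable_fun setT shift_s by exact: measurable_funD.
pose mu := measure_function_pushforward__canonical__measure_function_Measure
    (@lebesgue_measure R) ms.
move=> mA; suff E X : ocitv X -> lebesgue_measure X = mu X.
  by rewrite (lebesgue_measure_unique E mA).
move=> [[a b] /= ab <-].
rewrite /mu/= /pushforward.
rewrite (_ : _ @^-1` _ = `](a - s), (b - s)]%classic); last first.
  by apply/seteqP; split=> x /=; rewrite !in_itv/= ltrBlDr lerBrDr.
rewrite !lebesgue_measure_itv/= !lte_fin ltrD2r.
by case: ifP => // _; rewrite -!EFinD; congr EFin; ring.
Qed.

Lemma measurable_rV_shift (R : realType) (n : nat) (v : 'rV[R]_n) :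
  measurable_fun setT (fun x : 'rV[R]_n => x + v).
Proof.
apply: measurable_fun_rVP => i.
rewrite (_ : (fun _ => _) = (fun x : 'rV[R]_n => x 0 i + v 0 i)); last first.
  by apply/funext => x; rewrite mxE.
by apply: measurable_funD => //; exact: measurable_rV_coord.
Qed.

(** Induction on the dimension: Tonelli's theorem reduces the statement to the
    invariance of the sections, which is the induction hypothesis, and to the
    invariance of one-dimensional Lebesgue measure. *)
Lemma lebesgue_rV_shift (R : realType) (n : nat) (v : 'rV[R]_n)
    (A : set 'rV[R]_n) : measurable A ->
  lebesgue_rV R n ((fun x => x + v) @^-1` A) = lebesgue_rV R n A.
Proof.
elim: n => [|n IHn] in v A *.
  move=> mA; congr (lebesgue_rV R 0 _); apply/seteqP.
  by split=> x /=; rewrite (_ : x + v = x)//; apply/rowP; case.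
move=> mA; rewrite /= /lebesgue_rV_step /pushforward /=.
set B := @rV_cons R n @^-1` A.
have mB : measurable B.
  by rewrite -[B]setTI; exact: measurable_rV_cons.
pose s := v 0 ord0; pose w : 'rV[R]_n := \row_j v 0 (lift ord0 j).
have -> : @rV_cons R n @^-1` ((fun x => x + v) @^-1` A) =
    [set x | B (x.1 + s, x.2 + w)].
  apply/seteqP; split=> -[a y] /=; rewrite /B/=; congr A; apply/rowP => i.
    by rewrite !mxE; case: (unliftP ord0 i) => [j ->|->]/=; rewrite ?mxE.
  by rewrite !mxE; case: (unliftP ord0 i) => [j ->|->]/=; rewrite ?mxE.
pose shift_s : measurableTypeR R -> measurableTypeR R := fun x => x + s.
have ms : measurable_fun setT shift_s by exact: measurable_funD.
rewrite /product_measure1.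
transitivity (\int[lebesgue_measure]_x
    ((lebesgue_rV R n \o xsection B) (shift_s x)))%E.
  apply: eq_integral => x _ /=.
  rewrite -[RHS](IHn w); last exact: measurable_xsection.
  by congr (lebesgue_rV R n _).
pose leb_s := measure_function_pushforward__canonical__measure_function_Measure
    (@lebesgue_measure R) ms.
transitivity (\int[leb_s]_x (lebesgue_rV R n \o xsection B) x)%E.
  rewrite ge0_integral_pushforward//.
  exact: measurable_fun_xsection.
apply: eq_measure_integral => D mD _ /=.
exact: lebesgue_measure_shift.
Qed.

(** * Volume of sets with disjoint diagonal translates *)

(** The translates of [A] by [j * delta] along the diagonal, [j < M], are pairwise
    disjoint, have the volume of [A] and lie in the cube of side [2 * T] when
    [M * delta <= T].  With [M] the integer part of [T / delta] this leaves a
    single factor [delta], which is where the exponent [n], one less than the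
    dimension, comes from. *)
Lemma packing_bound (R : realType) (n : nat) (A : set 'rV[R]_n.+1) (T delta : R) :
  measurable A -> A `<=` cube n.+1 T -> 0 < delta <= T ->
  (forall (x y : 'rV[R]_n.+1) (s : R), A x -> A y -> delta <= s ->
     y != x + const_mx s) ->
  (lebesgue_rV R n.+1 A <= (2 ^+ n.+2 * T ^+ n * delta)%:E)%E.
Proof.
move=> mA AT /andP[delta0 deltaT] disjA.
have T0 : 0 < T := lt_le_trans delta0 deltaT.
pose M := Num.truncn (T / delta).
have Td0 : 0 <= T / delta by rewrite divr_ge0// ltW.
have /andP[MT TM] : M%:R <= T / delta < M.+1%:R by exact: truncn_itv.
have M1 : (1 <= M)%N by rewrite truncn_ge_nat// ler_pdivlMr// mul1r.
have MdT : M%:R * delta <= T by rewrite -ler_pdivlMr.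
pose v (j : nat) : 'rV[R]_n.+1 := const_mx (- (j%:R * delta)).
pose B j := (fun x => x + v j) @^-1` A.
have mB j : measurable (B j).
  by rewrite -[B j]setTI; exact: measurable_rV_shift.
have disjB : trivIset setT B.
  have lt_disj (i j : nat) x : (i < j)%N -> B i x -> B j x -> False.
    move=> ij Bix Bjx.
    have ds : delta <= (j%:R - i%:R) * delta.
      by rewrite ler_peMl ?(ltW delta0)// -natrB 1?ltnW// ler1n subn_gt0.
    have /eqP := disjA _ _ _ Bjx Bix ds; apply.
    by apply/rowP => k; rewrite !mxE; ring.
  move=> i j _ _ [x [Bix Bjx]].
  case: (ltngtP i j) => // ij; exfalso.
    exact: (lt_disj i j x).
  exact: (lt_disj j i x).
have BT : \big[setU/set0]_(j < M) B j `<=` cube n.+1 (2 * T).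
  rewrite -bigcup_mkord => x [j /= jM /AT xT] k; have := xT k; rewrite !mxE.
  have jd0 : 0 <= j%:R * delta by rewrite mulr_ge0// ltW.
  have : j%:R * delta <= M%:R * delta by rewrite ler_pM2r// ler_nat ltnW.
  lra.
have : (lebesgue_rV R n.+1 (\big[setU/set0]_(j < M) B j) <=
    ((2 * T) ^+ n.+1)%:E)%E.
  rewrite -lebesgue_rV_cube; last by rewrite mulr_ge0// ltW.
  apply: le_measure => //; rewrite inE.
    by apply: bigsetU_measurable => j _; exact: mB.
  exact: measurable_cube.
have finA : (lebesgue_rV R n.+1 A \is a fin_num)%E.
  rewrite ge0_fin_numE// (le_lt_trans _ (ltry (T ^+ n.+1)))//.
  rewrite -lebesgue_rV_cube ?(ltW T0)//; apply: le_measure => //; rewrite inE//.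
  exact: measurable_cube.
rewrite measure_bigsetU//.
rewrite (eq_bigr (fun=> (fine (lebesgue_rV R n.+1 A))%:E)); last first.
  by move=> j _; rewrite fineK//; exact: lebesgue_rV_shift.
rewrite sumEFin sumr_const card_ord -(fineK finA) !lee_fin -[_ *+ M]mulr_natl /=.
set a := fine _ => MA.
have a0 : 0 <= a by rewrite /a fine_ge0.
(* [T / delta < M + 1 <= 2 * M], as [delta <= T] makes [M] positive. *)
have T2M : T <= 2 * M%:R * delta.
  rewrite -ler_pdivrMr//; apply: (le_trans (ltW TM)).
  by rewrite -[M.+1]addn1 natrD mulr_natl mulr2n lerD2l ler1n.
rewrite -(ler_pM2r T0).
apply: (@le_trans _ _ (a * (2 * M%:R * delta))); first by rewrite ler_wpM2l.
rewrite (_ : a * _ = (M%:R * a) * (2 * delta)); last by ring.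
apply: (@le_trans _ _ ((2 * T) ^+ n.+1 * (2 * delta))).
  by rewrite ler_wpM2r// mulr_ge0// ltW.
by rewrite le_eqVlt; apply/orP; left; apply/eqP; rewrite exprMn !exprS; ring.
Qed.

(** * Regularity of the distribution function *)

Lemma continuous_cdf_homo (R : realType) (d : nat) (F : 'rV[R]_d -> R)
    (x y : 'rV[R]_d) : continuous_cdf F -> orthant R d x ->
  (forall i, x 0 i <= y 0 i) -> F x <= F y.
Proof.
move=> [_ [mu [_ muF]]] x0 xy.
have y0 : orthant R d y by move=> i; exact: le_trans (x0 i) (xy i).
rewrite -lee_fin -muF// -muF//; apply: le_measure; rewrite ?inE.
- by apply: (@measurable_rV_box R d (fun i => `]-oo, x 0 i]%classic)) => i;
    exact: measurable_itv.
- by apply: (@measurable_rV_box R d (fun i => `]-oo, y 0 i]%classic)) => i;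
    exact: measurable_itv.
- by move=> z /= zx i; exact: le_trans (zx i) (xy i).
Qed.

Lemma nbhs_rVP (R : realType) (d : nat) (x : 'rV[R]_d) (Q : set 'rV[R]_d) :
  nbhs x Q ->
  exists2 e : R, 0 < e & forall y : 'rV[R]_d, (forall i, `|y 0 i - x 0 i| < e) -> Q y.
Proof.
move=> /nbhs_ballP[e /= e0 xeQ]; exists e => // y yx; apply: xeQ.
by split=> // i j; rewrite ord1 /ball/= distrC.
Qed.

(** By monotonicity and continuity, the sublevel set [{F < t}] of the orthant is
    the union of the boxes [[0, q]] over the rational points [q] with [F q < t].
    This description shows that it belongs to the sigma-algebra generated by the
    coordinates, without comparing the latter with the Borel sets of the norm. *)
Lemma continuous_cdf_measurable (R : realType) (d : nat) (F : 'rV[R]_d -> R) :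
  continuous_cdf F -> measurable_fun (orthant R d) F.
Proof.
move=> cF mO; apply: (measurability _ (RGenCInfty.measurableE R)) => //.
move=> _ [_ [t ->] <-].
pose box (q : 'rV[rat]_d) :=
  if `[< orthant R d (map_mx ratr q) /\ F (map_mx ratr q) < t >]
  then [set x : 'rV[R]_d | forall i, `[0, ratr (q 0 i)]%classic (x 0 i)] else set0.
rewrite (_ : _ `&` _ = orthant R d `\` \bigcup_q box q); last first.
  apply/seteqP; split=> x [x0 /=].
    rewrite in_itv/= andbT => tx; split=> // -[q _].
    rewrite /box; case: asboolP => // -[q0 qt] xq.
    have : F x <= F (map_mx ratr q).
      apply: continuous_cdf_homo => // i; rewrite mxE.
      by have := xq i; rewrite /= in_itv/= => /andP[].
    by move=> /le_lt_trans/(_ qt); rewrite ltNge tx.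
  move=> xbox; split=> //=; rewrite in_itv/= andbT leNgt; apply/negP => xt.
  apply: xbox; have [/subspace_continuousP/(_ x x0) Fx _] := cF.
  have [e e0 eF] : exists2 e : R, 0 < e &
      forall y : 'rV[R]_d, (forall i, `|y 0 i - x 0 i| < e) -> orthant R d y -> F y < t.
    by apply: nbhs_rVP; exact: (Fx _ (lt_nbhsl xt)).
  have xe i : x 0 i < x 0 i + e by rewrite ltrDl.
  pose q : 'rV[rat]_d := \row_i sval (cid (rat_in_itvoo (xe i))).
  have xq i : x 0 i < ratr (q 0 i) < x 0 i + e.
    by rewrite mxE; case: cid => /= a; rewrite in_itv.
  have q0 : orthant R d (map_mx ratr q).
    move=> i; rewrite mxE; have /andP[+ _] := xq i; move/ltW.
    by apply: le_trans; exact: x0.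
  exists q => //; rewrite /box; case: asboolP => [_ i|[]].
    by rewrite /= in_itv/= x0/=; have /andP[/ltW] := xq i.
  split=> //; apply: eF => // i; rewrite mxE.
  by have := xq i; rewrite ltr_norml => /andP[]; lra.
apply: measurableD; first exact: measurable_orthant.
apply: countable_bigcupT_measurable => // q; rewrite /box; case: asboolP => // _.
by apply: (@measurable_rV_box R d (fun i => `[0, ratr (q 0 i)]%classic)) => i;
  exact: measurable_itv.
Qed.

(** At a point with positive coordinates the increments along the diagonal stay in
    the orthant, so a gradient relative to the orthant gives a two-sided
    derivative along the diagonal. *)
Lemma is_gradient_diag (R : realType) (d : nat) (F : 'rV[R]_d -> R)
    (x g : 'rV[R]_d) (s : R) :
  (forall i, 0 < (x + const_mx s) 0 i) ->
  is_gradient F (x + const_mx s) g ->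
  is_derive s 1 (fun u => F (x + const_mx u)) (\sum_i g 0 i).
Proof.
move=> xs0 Fg.
suff H : (fun h : R =>
    h^-1 *: (((fun u => F (x + const_mx u)) \o shift s) (h *: 1)
      - F (x + const_mx s))) @ 0^' --> \sum_i g 0 i.
  apply: DeriveDef; first by apply/cvg_ex; eexists; exact: H.
  by apply: cvg_lim => //; exact: H.
apply/cvgrPdist_le => e e0.
(* [enorm (const_mx h)] is [|h| * sqrt d]; the 1 keeps the denominator positive. *)
pose e1 := e / (Num.sqrt d%:R + 1).
have sd0 : 0 < Num.sqrt d%:R + 1 :> R by rewrite ltr_pwDr// sqrtr_ge0.
have e10 : 0 < e1 by rewrite divr_gt0.
have [a a0 aF] := nbhs_rVP (Fg _ e10).
(* Increments smaller than every coordinate stay in the orthant. *)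
have [b b0 bF] : exists2 b : R, 0 < b &
    forall i, b <= (x + const_mx s) 0 i.
  exists (\big[Num.min/1]_i (x + const_mx s) 0 i).
    by elim/big_ind: _ => // u w u0 w0; rewrite lt_min u0.
  by move=> i; exact: bigmin_le_cond.
near=> h.
have h0 : h != 0 by near: h; exact: nbhs_dnbhs_neq.
have hab : `|h| < Num.min a b.
  by near: h; apply: dnbhs0_lt; rewrite lt_min a0.
move: hab; rewrite lt_min => /andP[ha hb].
have : `|F (x + const_mx (h + s)) - F (x + const_mx s)
      - h * \sum_i g 0 i| <= e1 * (`|h| * Num.sqrt d%:R).
  have -> : h * (\sum_i g 0 i) = \sum_i g 0 i *
      ((x + const_mx (h + s)) - (x + const_mx s)) 0 i.
    by rewrite mulr_sumr; apply: eq_bigr => i _; rewrite !mxE; ring.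
  have -> : `|h| * Num.sqrt d%:R =
      enorm ((x + const_mx (h + s)) - (x + const_mx s)).
    rewrite /enorm (eq_bigr (fun=> h ^+ 2)) => [|i _]; last first.
      by rewrite !mxE; congr (_ ^+ 2); ring.
    rewrite sumr_const card_ord -[h ^+ 2 *+ d]mulr_natr.
    by rewrite sqrtrM ?sqr_ge0// sqrtr_sqr.
  apply: aF => i; first by rewrite !mxE (_ : _ - _ = h)//; ring.
  have := bF i; rewrite !mxE => bi.
  by move: hb; rewrite ltr_norml => /andP[]; lra.
rewrite /= /shift/= [h *: 1]mulr1 => Hh.
have -> : \sum_i g 0 i -
      h^-1 *: (F (x + const_mx (h + s)) - F (x + const_mx s)) =
    - (h^-1 * (F (x + const_mx (h + s)) - F (x + const_mx s)
      - h * \sum_i g 0 i)).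
  by rewrite [_ *: _]mulrC mulrBr mulKf//; ring.
rewrite normrN normrM normfV ler_pdivrMl ?normr_gt0//.
apply: (le_trans Hh); rewrite mulrCA ler_wpM2l//.
rewrite /e1 -mulrA ler_piMr ?(ltW e0)// ler_pdivrMl// mulr1.
by rewrite lerDl.
Unshelve. all: by end_near.
Qed.

(** * Growth along the diagonal and volume of the level bands *)

Lemma is_gradient_ge0 (R : realType) (d : nat) (F : 'rV[R]_d -> R)
    (x g : 'rV[R]_d) (i : 'I_d) :
  (forall y : 'rV[R]_d, (forall j, x 0 j <= y 0 j) -> F x <= F y) ->
  orthant R d x -> is_gradient F x g -> 0 <= g 0 i.
Proof.
move=> Fx x0 Fg; apply/ler_addgt0Pl => e e0.
have [a a0 aF] := nbhs_rVP (Fg _ e0).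
pose h := a / 2; have h0 : 0 < h by rewrite divr_gt0.
pose y := x + h *: delta_mx 0 i.
have yx j : (y - x) 0 j = h * (j == i)%:R.
  by rewrite !mxE eqxx/=; ring.
have yxE j : y 0 j - x 0 j = h * (j == i)%:R by rewrite -yx !mxE.
have xy j : x 0 j <= y 0 j by rewrite -subr_ge0 yxE mulr_ge0// ltW.
have : `|F y - F x - g 0 i * h| <= e * h.
  have -> : g 0 i * h = \sum_j g 0 j * (y - x) 0 j.
    rewrite (bigD1 i)//= big1 => [|j ji]; rewrite yx.
      by rewrite eqxx mulr1 addr0.
    by rewrite (negPf ji) !mulr0.
  rewrite [in leRHS](_ : h = enorm (y - x)); last first.
    rewrite /enorm (bigD1 i)//= big1 => [|j ji]; rewrite yx.
      by rewrite eqxx mulr1 addr0 sqrtr_sqr gtr0_norm.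
    by rewrite (negPf ji) mulr0 expr0n.
  apply: aF => j; last exact: le_trans (x0 j) (xy j).
  rewrite yxE normrM gtr0_norm//; apply: (@le_lt_trans _ _ h).
    by rewrite ler_piMr ?(ltW h0)//; case: eqP; rewrite ?normr1 ?normr0.
  by rewrite /h; lra.
rewrite ler_norml => /andP[_]; have := Fx y xy; rewrite -subr_ge0 => Fxy Hg.
have : 0 <= (e + g 0 i) * h by lra.
by rewrite pmulr_lge0.
Qed.

(** [\sum_i g_i ^ 2 <= (\sum_i g_i) ^ 2], as the cross terms are nonnegative. *)
Lemma enorm_le_sum (R : realType) (d : nat) (g : 'rV[R]_d) :
  (forall i, 0 <= g 0 i) -> enorm g <= \sum_i g 0 i.
Proof.
move=> g0; have S0 : 0 <= \sum_i g 0 i by exact: sumr_ge0.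
rewrite -[leRHS]ger0_norm// -sqrtr_sqr ler_sqrt ?sqr_ge0// [leRHS]expr2 mulr_sumr.
apply: ler_sum => i _; rewrite expr2 ler_wpM2r//.
by rewrite (bigD1 i)//= lerDl sumr_ge0.
Qed.

(** The lower bound on the gradient is only available near the level [c]; by
    monotonicity all values of [F] between the two end points stay in the band
    [[c - r, c + r]], and the mean value theorem applies.  Positivity of the
    coordinates of [x] keeps the whole segment away from the origin, where [F] may
    fail to be differentiable, and from the faces, where the derivative along the
    diagonal would be one-sided. *)
Lemma diag_growth (R : realType) (n : nat) (F : 'rV[R]_n.+1 -> R) (c r zeta m : R)
    (x : 'rV[R]_n.+1) (s : R) :
  continuous_cdf F -> twice_differentiable_on (orthant R n.+1 `\ 0) F ->
  0 < zeta -> (m%:E <= inf_gradient F c r zeta)%E ->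
  (forall i, 0 < x 0 i) -> 0 <= s ->
  c - r <= F x -> F (x + const_mx s) <= c + r ->
  m * s <= F (x + const_mx s) - F x.
Proof.
move=> cF dF zeta0 mF x0 s0 Fx Fxs.
pose phi u := F (x + const_mx u).
pose dphi u := \sum_i gradient F (x + const_mx u) 0 i.
have pos (u : R) : 0 <= u -> forall i, 0 < (x + const_mx u) 0 i.
  by move=> u0 i; rewrite !mxE ltr_wpDr.
have posO (u : R) : 0 <= u -> orthant R n.+1 (x + const_mx u).
  by move=> u0 i; exact/ltW/pos.
have grad (u : R) : 0 <= u ->
    is_gradient F (x + const_mx u) (gradient F (x + const_mx u)).
  move=> u0; have [|gF _] := dF (x + const_mx u); last exact: (xgetPex 0 gF).
  split; first exact: posO.
  by move=> /rowP/(_ ord0)/eqP; rewrite [_ == _]gt_eqF// mxE; exact: pos.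
have ge_m (u : R) : 0 <= u <= s -> m <= dphi u.
  move=> /andP[u0 us].
  apply: (@le_trans _ _ (enorm (gradient F (x + const_mx u)))).
    rewrite -lee_fin (le_trans mF)//; apply: ereal_inf_lbound.
    exists (x + const_mx u) => //; split; first exact: posO.
    exists (x + const_mx u); split; [exact: posO| |].
      have : F x <= F (x + const_mx u).
        apply: continuous_cdf_homo => // i; first exact: ltW.
        by rewrite !mxE lerDl.
      have : F (x + const_mx u) <= F (x + const_mx s).
        apply: continuous_cdf_homo => // i; first exact: posO.
        by rewrite !mxE lerD2l.
      by rewrite ler_norml; lra.
    rewrite subrr /enorm big1 ?sqrtr0 ?(ltW zeta0)// => i _.
    by rewrite mxE expr0n.
  apply: enorm_le_sum => i; apply: is_gradient_ge0 (grad u u0).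
    by move=> y xy; apply: continuous_cdf_homo => //; exact: posO.
  exact: posO.
have dphiE (u : R) : 0 <= u -> is_derive u 1 phi (dphi u).
  by move=> u0; apply: is_gradient_diag; [exact: pos|exact: grad].
have [||u] := @MVT_segment R phi dphi 0 s s0.
- by move=> u; rewrite in_itv/= => /andP[/ltW u0 _]; exact: dphiE.
- apply: derivable_within_continuous => u; rewrite in_itv/= => /andP[u0 _].
  by have [] := dphiE u u0.
have x0E : x + const_mx 0 = x by apply/rowP => i; rewrite !mxE addr0.
rewrite in_itv/= /phi x0E subr0 => us ->.
by rewrite ler_wpM2r// ge_m.
Qed.

(** Two points of the band on a common diagonal are at distance (measured by the
    diagonal parameter) at most [2 * eps / m].  Translating by [3 * eps / m] rather
    than by anything closer to [2 * eps / m] leaves room for the detour through an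
    interior point in the proof. *)
Lemma level_band_volume (R : realType) (n : nat) (F : 'rV[R]_n.+1 -> R)
    (c r zeta m eps T : R) :
  continuous_cdf F -> twice_differentiable_on (orthant R n.+1 `\ 0) F ->
  0 < zeta -> 0 < m -> (m%:E <= inf_gradient F c r zeta)%E ->
  0 < eps <= r -> 3 * eps / m <= T ->
  (lebesgue_rV R n.+1 (cube n.+1 T `&` [set x | (`|F x - c| <= eps)%R]) <=
    (2 ^+ n.+2 * T ^+ n * (3 * eps / m))%:E)%E.
Proof.
move=> cF dF zeta0 m0 mF /andP[e0 er] eT.
have d0 : 0 < 3 * eps / m by rewrite divr_gt0// mulr_gt0.
have subO : cube n.+1 T `<=` orthant R n.+1 by move=> x xT i; have /andP[] := xT i.
apply: packing_bound; rewrite ?d0//.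
- have -> : cube n.+1 T `&` [set x | `|F x - c| <= eps] =
      cube n.+1 T `&` (orthant R n.+1 `&` F @^-1` `[c - eps, c + eps]%classic).
    apply/seteqP; split=> x [xT] /=; rewrite in_itv/= -ler_distl//.
      by split=> //; split=> //; exact: subO.
    by case.
  apply: measurableI; first exact: measurable_cube.
  apply: continuous_cdf_measurable => //; first exact: measurable_orthant.
move=> x y s [xT xe] [yT ye] ds; apply/eqP => yx.
(* [x] may lie on a face of the orthant: growth is applied from the interior
   point [x + const_mx u] only, and loses the factor [5 / 6]. *)
pose u := s / 6; have s0 : 0 < s := lt_le_trans d0 ds.
have u0 : 0 < u by rewrite divr_gt0.
have yE : y = x + const_mx u + const_mx (s - u).
  by rewrite yx; apply/rowP => i; rewrite !mxE; ring.
have Fxu : F x <= F (x + const_mx u).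
  apply: continuous_cdf_homo => // i; first exact: subO.
  by rewrite !mxE lerDl ltW.
move: xe ye; rewrite /= !ler_norml => /andP[xe1 xe2] /andP[ye1 ye2].
have : m * (s - u) <= F y - F (x + const_mx u).
  rewrite yE; apply: (@diag_growth _ _ _ c r zeta) => //; rewrite -?yE.
  - by move=> i; rewrite !mxE ltr_wpDl//; exact: (subO _ xT i).
  - by rewrite /u; lra.
  - lra.
  - lra.
have : 3 * eps <= m * s by rewrite [leRHS]mulrC -ler_pdivrMr.
have -> : m * (s - u) = 5 / 6 * (m * s) by rewrite /u; field.
lra.
Qed.

(** * Distance between level sets and integrated error *)

(** At a point of the symmetric difference, [c] separates [F x] from [G x], so
    [|F x - c| <= |F x - G x|].  Such a point is thus in the band around the level
    [c], or [|F x - G x| > eps]; Markov's inequality for [|F - G| ^ p] bounds the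
    measure of the second set. *)
Lemma level_set_distance (R : realType) (d : nat) (F G : 'rV[R]_d -> R)
    (c T eps p V J : R) :
  measurable_fun (orthant R d) F -> measurable_fun (orthant R d) G ->
  0 < eps -> 0 < p ->
  (lebesgue_rV R d (cube d T `&` [set x | (`|F x - c| <= eps)%R]) <= V%:E)%E ->
  (\int[lebesgue_rV R d]_(x in cube d T) (`|F x - G x| `^ p)%:E <= J%:E)%E ->
  (sym_diff_measure (upper_level F c T) (upper_level G c T) <=
    (V + J / eps `^ p)%:E)%E.
Proof.
move=> mF mG e0 p0 FV FGJ.
have subO : cube d T `<=` orthant R d by move=> x xT i; have /andP[] := xT i.
have mC := @measurable_cube R d T.
have mFC : measurable_fun (cube d T) F.
  exact: measurable_funS (@measurable_orthant R d) subO mF.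
have mGC : measurable_fun (cube d T) G.
  exact: measurable_funS (@measurable_orthant R d) subO mG.
have mL (H : 'rV[R]_d -> R) : measurable_fun (cube d T) H ->
    measurable (upper_level H c T).
  move=> mH; have -> : upper_level H c T = cube d T `&` H @^-1` `[c, +oo[%classic.
    by apply/seteqP; split=> x [xT] /=; rewrite in_itv/= andbT.
  exact: mH.
pose g x : \bar R := (`|F x - G x| `^ p)%:E.
have mg : measurable_fun (cube d T) g.
  apply/measurable_EFinP.
  apply: (measurableT_comp (measurable_powR p)).
  by apply: measurableT_comp => //; exact: measurable_funB.
have ep0 : 0 < eps `^ p by rewrite powR_gt0.
pose S1 := cube d T `&` [set x | (`|F x - c| <= eps)%R].
pose S2 := cube d T `&` [set x | ((eps `^ p)%:E <= g x)%E].
have mS1 : measurable S1.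
  rewrite (_ : S1 = cube d T `&` F @^-1` `[c - eps, c + eps]%classic).
    exact: mFC.
  by apply/seteqP; split=> x [xT] /=; rewrite in_itv/= -ler_distl.
have mS2 : measurable S2.
  rewrite (_ : S2 = cube d T `&` g @^-1` `[(eps `^ p)%:E, +oo[%classic).
    by apply: mg => //; exact: emeasurable_itv.
  by apply/seteqP; split=> x [xT] /=; rewrite in_itv/= andbT.
have subS : upper_level F c T `+` upper_level G c T `<=` S1 `|` S2.
  move=> x FGx; have [xT FG] : cube d T x /\ `|F x - c| <= `|F x - G x|.
    case: FGx => [[[xT cF] xG]|[[xT cG] xF]]; split=> //.
      have Gc : G x < c by rewrite ltNge; apply/negP => cG; exact: xG.
      by rewrite !ger0_norm; lra.
    have Fc : F x < c by rewrite ltNge; apply/negP => cF; exact: xF.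
    by rewrite !ler0_norm; lra.
  have [Fe|eF] := leP `|F x - c| eps; [by left|right; split=> //=].
  rewrite lee_fin; apply: ge0_ler_powR; rewrite ?nnegrE.
  - exact: ltW.
  - exact: ltW.
  - exact: normr_ge0.
  - exact: le_trans (ltW eF) FG.
have S2J : (lebesgue_rV R d S2 <= (J / eps `^ p)%:E)%E.
  have := @le_integral_comp_abse _ _ _ (lebesgue_rV R d) _ mC g _ id
    (@measurable_id _ _ _) (fun _ => id) (fun _ _ _ _ => id) mg ep0.
  have gE x : (`|g x| = g x)%E by apply: gee0_abs; rewrite lee_fin powR_ge0.
  under eq_integral do rewrite gE.
  under [in X in X -> _]eq_set do rewrite gE.
  move=> /le_trans/(_ FGJ).
  rewrite muleC -lee_pdivlMr//.
apply: (@le_trans _ _ (lebesgue_rV R d (S1 `|` S2))).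
  apply: le_measure => //; rewrite inE; last exact: measurableU.
  by apply: measurableU; apply: measurableD; exact: mL.
by rewrite EFinD (le_trans (measureU2 _ _ _))// leeD.
Qed.

(** Lets almost sure properties be used inside outer probabilities. *)
Lemma mu_ext_le_negligible (R : realType) (dO : measure_display)
    (Omega : measurableType dO) (P : probability Omega R) (A B N : set Omega) :
  P.-negligible N -> A `<=` B `|` N -> (mu_ext P A <= mu_ext P B)%E.
Proof.
move=> [M [mM M0 NM]] AB.
apply: (@le_trans _ _ (mu_ext P (B `|` M))).
  by apply: le_mu_ext => w /AB[Bw|/NM Mw]; [left|right].
have PM : mu_ext P M = 0%E by rewrite -M0; exact: measurable_mu_extE.
have : (mu_ext P (B `|` M) <= mu_ext P B + mu_ext P M)%E.
  exact: outer_measureU2.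
by rewrite PM adde0.
Qed.

(** With [eps := eta / (K * q * T ^ n)], the quantity [q * eps ^ (- p) / v] equals
    [(K / eta) ^ p * q ^ (p + 1) * T ^ (n * p) / v]; the last three factors are
    the power [p + 1] of the ratio that is assumed to be at most [k]. *)
Lemma rate_bound (R : realType) (n : nat) (p q v T K eta k : R) :
  1 <= p -> 0 < q -> 0 < v -> 0 < T -> 0 < K -> 0 < eta -> 0 < k ->
  q <= k * (v `^ (1 / (p + 1)) / T `^ (n%:R * p / (p + 1))) ->
  q * (v^-1 / (eta / (K * q * T ^+ n)) `^ p) <= k `^ (p + 1) * (K / eta) `^ p.
Proof.
move=> p1 q0 v0 T0 K0 eta0 k0 qk.
have p0 : 0 < p by lra.
have p10 : p + 1 != 0 by apply: lt0r_neq0; lra.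
have Tn0 : 0 < T ^+ n by rewrite exprn_gt0.
have Tp0 : 0 < (T ^+ n) `^ p by rewrite powR_gt0.
pose y := T `^ (n%:R * p / (p + 1)); have y0 : 0 < y by rewrite powR_gt0.
have qy : q * y <= k * v `^ (1 / (p + 1)) by rewrite -ler_pdivlMr// -mulrA.
have yp : y `^ (p + 1) = (T ^+ n) `^ p.
  by rewrite /y -powRrM divfK// powRrM powR_mulrn// ltW.
have qp : q `^ (p + 1) * (T ^+ n) `^ p <= k `^ (p + 1) * v.
  have vp0 : 0 < v `^ (1 / (p + 1)) by rewrite powR_gt0.
  have -> : k `^ (p + 1) * v = (k * v `^ (1 / (p + 1))) `^ (p + 1).
    by rewrite (powRM _ (ltW k0) (ltW vp0)) -powRrM divfK// powRr1// ltW.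
  rewrite -yp -(powRM _ (ltW q0) (ltW y0)).
  apply: (ge0_ler_powR _ _ _ qy).
  - by lra.
  - by rewrite nnegrE; exact/ltW/mulr_gt0.
  - by rewrite nnegrE; exact/ltW/mulr_gt0.
have -> : eta / (K * q * T ^+ n) = (K / eta * q * T ^+ n)^-1.
  by field; rewrite !gt_eqF.
have iE (u : R) : 0 < u -> (u^-1) `^ p = (u `^ p)^-1.
  move=> u0; apply: (mulIf (x := u `^ p)); first by rewrite gt_eqF ?powR_gt0.
  rewrite -powRM ?invr_ge0 ?ltW// !mulVf ?gt_eqF ?powR_gt0//.
  by rewrite powR1.
have Ke0 : 0 < K / eta by rewrite divr_gt0.
have Keq0 : 0 < K / eta * q by exact: mulr_gt0.
rewrite (iE _ (mulr_gt0 Keq0 Tn0)) invrK.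
rewrite (powRM _ (ltW Keq0) (ltW Tn0)) (powRM _ (ltW Ke0) (ltW q0)).
have -> : q * (v^-1 * ((K / eta) `^ p * q `^ p * (T ^+ n) `^ p)) =
    (q `^ (p + 1) * (T ^+ n) `^ p) / v * (K / eta) `^ p.
  rewrite powRD ?powRr1 ?(ltW q0)//; last by rewrite (negPf p10).
  by ring.
by rewrite ler_wpM2r ?powR_ge0// ler_pdivrMr.
Qed.

(** * Convergence in probability *)

Theorem theorem3p1 (R : realType) (d : nat) (c : R) (F : 'rV[R]_d -> R)
    (r zeta : R)
    (dO : measure_display) (Omega : measurableType dO) (P : probability Omega R)
    (X : forall n : nat, 'I_n -> {RV P >-> 'rV[R]_d})
    (Fn : nat -> Omega -> 'rV[R]_d -> R)
    (p : R) (v T : nat -> R) :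
  (1 <= d)%N ->
  0 < c < 1 ->
  continuous_cdf F ->
  twice_differentiable_on (orthant R d `\ 0) F ->
  0 < r ->
  0 < zeta ->
  (0 < inf_gradient F c r zeta)%E ->
  (sup_hessian F c r zeta < +oo)%E ->
  (forall n, (0 < n)%N -> iid_sample F (@X n)) ->
  (forall n, (0 < n)%N -> estimator_from (@X n) (Fn n)) ->
  (forall n, (0 < n)%N ->
     {ae P, forall w, measurable_fun (orthant R d) (Fn n w)}) ->
  1 <= p ->
  positive_increasing v ->
  positive_increasing T ->
  cvg_probability0 P (fun n w =>
    ((v n)%:E * \int[lebesgue_rV R d]_(x in cube d (T n))
       (`|F x - Fn n w x| `^ p)%:E)%E) ->
  (forall t : R, `|t - c| <= r ->
     relative_boundary (cube d (T 1%N)) (upper_level F t (T 1%N)) !=set0) ->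
  forall q : nat -> R,
    positive_increasing q ->
    (q : nat -> R^o) =o_\oo
      (fun n => v n `^ (1 / (p + 1)) /
                T n `^ ((d%:R - 1) * p / (p + 1)) : R^o) ->
    cvg_probability0 P (fun n w =>
      ((q n)%:E * sym_diff_measure (upper_level F c (T n))
                                   (upper_level (Fn n w) c (T n)))%E).
Proof.
move=> d1 _ cF dF r0 zeta0 mF _ _ _ mFn p1 [v0 _] [T0 Tincr] FnF _ q
  [q0 qincr] qo.
case: d d1 => [//|n] _ in F X Fn cF dF mF mFn FnF qo *.
have {qo} qo k : 0 < k -> \forall i \near \oo,
    q i <= k * (v i `^ (1 / (p + 1)) / T i `^ (n%:R * p / (p + 1))).
  move=> k0; have /eqoP/(_ _ k0) qk := qo.
  near=> i; have i0 : (0 < i)%N by near: i; exact: nbhs_infty_gt.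
  have : `|q i| <= k * `|v i `^ (1 / (p + 1)) /
      T i `^ ((n.+1%:R - 1) * p / (p + 1))| by near: i.
  rewrite (_ : n.+1%:R - 1 = n%:R); last by rewrite -[n.+1]addn1 natrD addrK.
  by rewrite !ger0_norm ?divr_ge0 ?powR_ge0 ?(ltW (q0 _ i0)).
have [m m0 {}mF] : exists2 m : R, 0 < m & (m%:E <= inf_gradient F c r zeta)%E.
  case: (inf_gradient F c r zeta) mF => [m m0| |//].
    by exists m.
  by exists 1 => //; rewrite leey.
have p0 : 0 < p by lra.
have T10 : 0 < T 1%N by exact: T0.
have q10 : 0 < q 1%N by exact: q0.
have Tn10 : 0 < T 1%N ^+ n by exact: exprn_gt0.
(* The constant in [level_band_volume], where the width is [3 * eps / m]. *)
pose K := 2 ^+ n.+2 * (3 / m).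
have K0 : 0 < K by rewrite mulr_gt0 ?exprn_gt0 ?divr_gt0.
move=> e e0.
pose D := K * q 1%N * T 1%N ^+ n.
have D0 : 0 < D by exact: mulr_gt0 (mulr_gt0 K0 q10) Tn10.
(* The second bound on [eta] makes the width [eps] chosen below at most [r] and at
   most [m * T_1 / 3] for every index, since [D] is the least denominator. *)
pose eta := Num.min (e / 3) (D * Num.min r (m * T 1%N / 3)).
have eta0 : 0 < eta.
  by rewrite lt_min divr_gt0//= mulr_gt0// lt_min r0/= divr_gt0// mulr_gt0.
(* Chosen so that the bound of [rate_bound] is [e / 3]. *)
pose k := (e / 3 / (K / eta) `^ p) `^ (1 / (p + 1)).
have Ke0 : 0 < (K / eta) `^ p by apply: powR_gt0; exact: divr_gt0.
have ek0 : 0 < e / 3 / (K / eta) `^ p by rewrite !divr_gt0.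
have k0 : 0 < k by rewrite powR_gt0.
have kE : k `^ (p + 1) * (K / eta) `^ p = e / 3.
  have p10 : p + 1 != 0 by apply: lt0r_neq0; lra.
  rewrite /k -powRrM divfK// powRr1 ?(ltW ek0)// divfK//.
  by rewrite gt_eqF.
apply: (squeeze_cvge _ (cvg_cst 0%E) (FnF 1 ltr01)).
near=> i; have i0 : (0 < i)%N by near: i; exact: nbhs_infty_gt.
rewrite mu_ext_ge0//=.
apply: (mu_ext_le_negligible (mFn i i0)).
move=> w ew; have [mw|] := pselect (measurable_fun (orthant R n.+1) (Fn i w));
  last by right.
(* It remains to contradict [ew] on the event [v_i * \int |F - F_i| ^ p < 1]. *)
left; rewrite /= leNgt; apply/negP => Zw.
set I := (\int[lebesgue_rV R n.+1]_(x in cube n.+1 (T i)) _)%E in Zw.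
have I0 : (0 <= I)%E by apply: integral_ge0 => x _; rewrite lee_fin powR_ge0.
have vi0 := v0 _ i0; have qi0 := q0 _ i0; have Ti0 := T0 _ i0.
have Iv : (I <= (v i)^-1%:E)%E.
  rewrite gee0_abs ?mule_ge0 ?lee_fin ?(ltW vi0)// in Zw.
  by rewrite -[leRHS]mul1e muleC -lee_pdivrMl// ?invr_gt0// invrK ltW.
have Tni0 : 0 < T i ^+ n by exact: exprn_gt0.
pose eps := eta / (K * q i * T i ^+ n).
have den0 : 0 < K * q i * T i ^+ n by exact: mulr_gt0 (mulr_gt0 K0 qi0) Tni0.
have eps0 : 0 < eps by exact: divr_gt0.
have epsD : eps <= Num.min r (m * T 1%N / 3).
  rewrite /eps ler_pdivrMr//.
  apply: (@le_trans _ _ (D * Num.min r (m * T 1%N / 3))).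
    by rewrite ge_min lexx orbT.
  rewrite mulrC ler_wpM2l//.
    by rewrite le_min (ltW r0)/= divr_ge0// mulr_ge0// ltW.
  apply: ler_pM.
  - exact/ltW/mulr_gt0.
  - exact: ltW.
  - by rewrite ler_pM2l//; exact: qincr.
  - by rewrite lerXn2r ?nnegrE ?(ltW T10) ?(ltW Ti0)//; exact: Tincr.
move: epsD; rewrite le_min => /andP[epsr epsT].
have epsTi : 3 * eps / m <= T i.
  apply: (le_trans _ (Tincr 1%N i isT i0)).
  by rewrite ler_pdivrMr//; lra.
have band : (lebesgue_rV R n.+1
    (cube n.+1 (T i) `&` [set x | (`|F x - c| <= eps)%R]) <=
    (K * T i ^+ n * eps)%:E)%E.
  have -> : K * T i ^+ n * eps = 2 ^+ n.+2 * T i ^+ n * (3 * eps / m).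
    by rewrite /K; ring.
  by apply: (level_band_volume (r := r) (zeta := zeta)) => //; rewrite eps0.
have := level_set_distance (continuous_cdf_measurable cF) mw eps0 p0 band Iv.
set S := sym_diff_measure _ _ => SV.
have S0 : (0 <= S)%E by exact: measure_ge0.
have := ew; rewrite /= gee0_abs ?mule_ge0 ?lee_fin ?(ltW qi0)//.
rewrite leNgt => /negP; apply.
apply: (@le_lt_trans _ _
    ((q i)%:E * (K * T i ^+ n * eps + (v i)^-1 / eps `^ p)%:E)%E).
  by rewrite lee_wpmul2l// lee_fin ltW.
rewrite -EFinM lte_fin mulrDr.
have -> : q i * (K * T i ^+ n * eps) = eta.
  by rewrite /eps; field; rewrite !gt_eqF.
have qk : q i <= k * (v i `^ (1 / (p + 1)) / T i `^ (n%:R * p / (p + 1))).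
  by near: i; exact: qo.
have := rate_bound p1 qi0 vi0 Ti0 K0 eta0 k0 qk; rewrite -/eps kE => rest.
have : eta <= e / 3 by rewrite ge_min lexx.
lra.
Unshelve. all: by end_near.
Qed.
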